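(* For each $(d,n)\in\{(21,896),(22,1408),(23,2300)\}$ there exists a set $\mathcal{X}\subset\mathbb{R}^d$ of unit vectors with $|\mathcal{X}|=n$ spanning biangular lines with $A(\mathcal{X})\subseteq\{0,\pm1/3\}$.
   Context: For a finite set $\mathcal{X}\subset\mathbb{R}^d$ of unit vectors put $A(\mathcal{X}):=\{\langle x,x'\rangle\colon x\neq x';\ x,x'\in\mathcal{X}\}$. The set $\mathcal{X}$ spans a system of biangular lines (the lines through the origin in the directions $x\in\mathcal{X}$) if $-1\notin A(\mathcal{X})$ and $|\{\gamma^2\colon\gamma\in A(\mathcal{X})\}|\leq 2$. *)

(* Defs.v *)
From mathcomp Require Import all_boot all_order all_algebra.
From mathcomp Require Import finmap.
From mathcomp Require Import reals.

Set Implicit Arguments.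
Unset Strict Implicit.
Unset Printing Implicit Defensive.

Import Order.TTheory GRing.Theory Num.Theory.

Local Open Scope fset_scope.
Local Open Scope ring_scope.

Definition dotv (R : realType) (d : nat) (x y : 'rV[R]_d) : R :=
  \sum_(i < d) x 0 i * y 0 i.

(* The Euclidean norm; MathComp-Analysis puts the sup norm on row vectors. *)
Definition enorm (R : realType) (d : nat) (x : 'rV[R]_d) : R :=
  Num.sqrt (dotv x x).

Definition unit_vectors (R : realType) (d : nat) (X : {fset 'rV[R]_d}) : Prop :=
  forall x, x \in X -> enorm x = 1.

Definition inner_products (R : realType) (d : nat) (X : {fset 'rV[R]_d}) :
    {fset R} :=
  [fset dotv x y | x in X, y in X & x != y].

Definition biangular_lines (R : realType) (d : nat) (X : {fset 'rV[R]_d}) : Prop :=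
  -1 \notin inner_products X
  /\ (#|` [fset g ^+ 2 | g in inner_products X]| <= 2)%N.

Lemma inner_productsP (R : realType) (d : nat) (X : {fset 'rV[R]_d}) (g : R) :
  g \in inner_products X <->
  exists x y : 'rV[R]_d, [/\ x \in X, y \in X, x != y & g = dotv x y].
Proof.
split.
  by case/imfset2P => x /= xX [y] /=; rewrite inE => /andP[yX xy] ->; exists x, y.
move=> [x [y [xX yX xy ->]]].
by apply/imfset2P; exists x => //; exists y; rewrite // inE yX.
Qed.

(* Main.v *)
Require Import Defs.
From mathcomp Require Import all_boot all_order all_algebra.
From mathcomp Require Import finmap.
From mathcomp Require Import reals.
From mathcomp Require Import zify ring lra.

Set Implicit Arguments.
Unset Strict Implicit.
Unset Printing Implicit Defensive.

Import Order.TTheory GRing.Theory Num.Theory.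

Local Open Scope fset_scope.
Local Open Scope ring_scope.

(* The three systems are, up to sign, the minimal vectors of the shorter Leech
   lattices O_21, O_22, O_23, scaled to norm 24 so that the admissible inner
   products are 0 and +-8.  A vector is (sqrt q * a; w) with w integral of
   length m = 24 - q.  Let D be the binary Golay code shortened at two (m = 22)
   or three (m = 21) points; its weights are 0, 8, 12, 16.  The vectors are
     (sqrt q; (-1)^c) for c in D,
     (0; +-2 on a hexad h), with an odd number of minus signs, up to sign,
     (2 sqrt 2; +-4 e_i), for m = 22 only,
   where the hexads are the words of weight 6 in a coset h0 + D all of whose
   weights are 2 mod 4.  For m = 22 this gives 1024 + 77 * 16 + 44 = 2300 lines,
   for m = 21 it gives 512 + 56 * 16 = 1408 lines, and the hexad vectors of
   length 21 alone give 896 lines.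
   Two sign vectors have inner product 24 - 2 wt(c + c').  Since the sum of two
   hexads is in D and the sum of a hexad and a word of D is in h0 + D, the
   weights force distinct hexads to meet in 0 or 2 points and a hexad to meet
   a word of D evenly; this settles the other inner products. *)

(** * Integer vectors and the passage to unit vectors *)

Fixpoint sdot (A : pzRingType) (s t : seq A) : A :=
  match s, t with
  | x :: s', y :: t' => x * y + sdot s' t'
  | _, _ => 0
  end.

Lemma sdotC (A : comPzRingType) (s t : seq A) : sdot s t = sdot t s.
Proof. by elim: s t => [|x s IH] [|y t] //=; rewrite mulrC IH. Qed.

Lemma sdot_map (A B : pzRingType) (f : {rmorphism A -> B}) (s t : seq A) :
  sdot (map f s) (map f t) = f (sdot s t).
Proof.
elim: s t => [|x s IH] [|y t] /=; rewrite ?rmorph0 //.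
by rewrite IH rmorphD rmorphM.
Qed.

Definition row_of_seq (R : realType) (d : nat) (s : seq R) : 'rV[R]_d :=
  \row_(i < d) nth 0 s i.

(** Only [s] has to have length [d]: [sdot] stops at the shorter sequence, and [nth] reads 0 beyond
    the end of [t]. *)
Lemma dotv_row_of_seq (R : realType) (d : nat) (s t : seq R) :
  size s = d -> dotv (row_of_seq d s) (row_of_seq d t) = sdot s t.
Proof.
rewrite /dotv; elim: s t d => [|x s IH] t [|d] //=.
  by rewrite big_ord0.
case=> szs.
rewrite big_ord_recl !mxE /=; case: t => [|y t].
  rewrite mulr0 add0r big1 // => i _; by rewrite !mxE nth_nil mulr0.
by rewrite -(IH t d szs); congr (_ + _); apply: eq_bigr => i _; rewrite !mxE.
Qed.

Lemma dotvZ (R : realType) (d : nat) (a : R) (x y : 'rV[R]_d) :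
  dotv (a *: x) (a *: y) = a ^+ 2 * dotv x y.
Proof.
rewrite /dotv mulr_sumr; apply: eq_bigr => i _; rewrite !mxE; ring.
Qed.

(* The form on integer sequences whose head is in units of sqrt q. *)
Definition wdot (q : nat) (v w : seq int) : int :=
  match v, w with
  | a :: s, b :: t => q%:Z * (a * b) + sdot s t
  | _, _ => 0
  end.

Definition admissible (z : int) : bool := z \in [:: 0; 8; -8].

Lemma wdotC q v w : wdot q v w = wdot q w v.
Proof. by case: v w => [|a s] [|b t] //=; rewrite sdotC (mulrC a). Qed.

Lemma pairwise_sym_in (T : eqType) (r : rel T) (s : seq T) :
  symmetric r -> pairwise r s -> {in s &, forall x y, x != y -> r x y}.
Proof.
move=> rC; elim: s => [|z s IH] //= /andP[/allP rz /IH{}IH] x y.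
rewrite !inE => /predU1P[->|xs] /predU1P[->|ys].
- by rewrite eqxx.
- by move=> _; apply: rz.
- by move=> _; rewrite rC; apply: rz.
- exact: IH.
Qed.

Definition wrow (R : realType) (d q : nat) (v : seq int) : 'rV[R]_d :=
  row_of_seq d
    (if v is a :: s then Num.sqrt q%:R * a%:~R :: [seq z%:~R | z <- s]
     else [::]).

Lemma dotv_wrow (R : realType) (d q : nat) (v w : seq int) : size v = d ->
  dotv (wrow R d q v) (wrow R d q w) = (wdot q v w)%:~R.
Proof.
move=> szv; rewrite dotv_row_of_seq; last by case: v szv => //= a s; rewrite size_map.
case: v w {szv} => [|a s] [|b t] //=.
rewrite sdot_map rmorphD /= !rmorphM /=; congr (_ + _).
have -> : (q%:Z)%:~R = Num.sqrt q%:R * Num.sqrt q%:R :> R.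
  by rewrite -expr2 sqr_sqrtr // ler0n.
ring.
Qed.

(** Distinctness comes from the pairwise condition: equal vectors would have inner product 24, which
    is not admissible. After scaling by 1 / sqrt 24 the same argument makes [f] injective on [V]. *)
Lemma biangular_of_seqs (R : realType) (d q : nat) (V : seq (seq int)) :
  all (fun v => (size v == d) && (wdot q v v == 24)) V ->
  pairwise (fun v w => admissible (wdot q v w)) V ->
  exists X : {fset 'rV[R]_d},
    [/\ unit_vectors X,
        #|` X| = size V,
        biangular_lines X
      & inner_products X `<=` [fset 0; 1 / 3; - (1 / 3)] ].
Proof.
move=> /allP Vok Vpw.
have uV : uniq V.
  rewrite uniq_pairwise; apply: sub_in_pairwise Vpw; last exact/allP/Vok.
  move=> v w /andP[_ /eqP vv] _ /= vw; apply/eqP => eqvw.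
  by move: vw; rewrite -eqvw vv.
have Vadm : {in V &, forall v w, v != w -> admissible (wdot q v w)}.
  apply: pairwise_sym_in Vpw => v w; by rewrite wdotC.
pose f v := (Num.sqrt 24)^-1 *: wrow R d q v.
have dotf : {in V, forall v w, dotv (f v) (f w) = (wdot q v w)%:~R / 24}.
  move=> v /Vok /andP[/eqP szv _] w.
  by rewrite dotvZ dotv_wrow // exprVn sqr_sqrtr ?ler0n // mulrC.
have dotff : {in V, forall v, dotv (f v) (f v) = 1}.
  move=> v vV; rewrite dotf //; have /andP[_ /eqP ->] := Vok v vV.
  by rewrite divff ?pnatr_eq0.
have val v w : v \in V -> w \in V -> v != w ->
    dotv (f v) (f w) \in [:: 0; 1 / 3; - (1 / 3)].
  move=> vV wV vw; have := Vadm v w vV wV vw; rewrite dotf //.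
  rewrite /admissible !inE => /or3P[] /eqP ->; apply/or3P;
    [apply: Or31|apply: Or32|apply: Or33]; apply/eqP; lra.
have injf : {in V &, injective f}.
  move=> v w vV wV eqf; apply/eqP/negPn/negP => vw.
  have := val v w vV wV vw; rewrite -eqf dotff // !inE => /or3P[] /eqP; lra.
exists [fset f v | v in V].
have ip : inner_products [fset f v | v in V] `<=` [fset 0; 1 / 3; - (1 / 3)].
  apply/fsubsetP => g /inner_productsP[x [y [/imfsetP[/= v vV ->]]]].
  move=> /imfsetP[/= w wV ->] fvw ->.
  have vw : v != w by apply: contraNneq fvw => ->.
  by have := val v w vV wV vw; rewrite !inE orbA.
split=> //.
- by move=> x /imfsetP[/= v vV ->]; rewrite /enorm dotff // sqrtr1.
- by rewrite card_in_imfset //= undup_id.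
split.
  apply/negP => /(fsubsetP ip); rewrite !inE => /orP[/orP[]|] /eqP; lra.
apply: (@leq_trans #|` [fset 0; 1 / 9 : R] |); last first.
  by rewrite cardfs2; case: (_ != _).
apply/fsubset_leq_card/fsubsetP => z /imfsetP[/= g /(fsubsetP ip)].
by rewrite !inE => /orP[/orP[]|] /eqP -> ->; apply/orP;
  [left|right|right]; apply/eqP; field.
Qed.

(** * Binary words: weight, sum, intersection *)

Definition wt (s : bitseq) : nat := count id s.

Definition xorw (s t : bitseq) : bitseq := [seq p.1 (+) p.2 | p <- zip s t].

Definition andw (s t : bitseq) : bitseq := [seq p.1 && p.2 | p <- zip s t].

Lemma xorw_cons x s y t : xorw (x :: s) (y :: t) = (x (+) y) :: xorw s t.
Proof. by []. Qed.

Lemma andw_cons x s y t : andw (x :: s) (y :: t) = (x && y) :: andw s t.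
Proof. by []. Qed.

Lemma xorwA : associative xorw.
Proof. by elim=> [|x s IH] [|y t] [|z u] //; rewrite !xorw_cons addbA; congr cons; apply: IH. Qed.

Lemma xorwC : commutative xorw.
Proof. by elim=> [|x s IH] [|y t] //; rewrite !xorw_cons addbC; congr cons; apply: IH. Qed.

Lemma xorw0 (s : bitseq) : xorw s (nseq (size s) false) = s.
Proof. by elim: s => [|x s IH] //; rewrite [nseq _ _]/= xorw_cons addbF; congr cons; apply: IH. Qed.

Lemma xorww (s : bitseq) : xorw s s = nseq (size s) false.
Proof. by elim: s => [|x s IH] //; rewrite xorw_cons addbb; congr cons; apply: IH. Qed.

Lemma size_xorw (s t : bitseq) : size s = size t -> size (xorw s t) = size s.
Proof. by move=> st; rewrite size_map size_zip st minnn. Qed.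

Lemma wt_xorw (s t : bitseq) : size s = size t ->
  (wt (xorw s t) + 2 * wt (andw s t) = wt s + wt t)%N.
Proof.
rewrite /wt; elim: s t => [|x s IH] [|y t] // [/IH]; rewrite xorw_cons andw_cons /=.
by case: x y => [] []; lia.
Qed.

Lemma wt_xorw_eq0 (s t : bitseq) : size s = size t -> wt (xorw s t) = 0%N ->
  s = t.
Proof.
rewrite /wt; elim: s t => [|x s IH] [|y t] // [/IH{}IH]; rewrite xorw_cons /=.
by case: x y => [] [] //= /IH ->.
Qed.

Lemma wt_mask (h c : bitseq) : size h = size c -> wt (mask h c) = wt (andw h c).
Proof.
rewrite /wt; elim: h c => [|x s IH] [|y t] // [/IH{}IH]; rewrite andw_cons /=.
by case: x => //=; rewrite IH.
Qed.

(** * Sign vectors and vectors supported on a word *)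

Definition sgn (c : bitseq) : seq int := [seq (if b then -1 else 1) | b <- c].

Fixpoint place (h : bitseq) (t : seq int) : seq int :=
  match h, t with
  | true :: h', x :: t' => x :: place h' t'
  | true :: h', [::] => 0 :: place h' [::]
  | false :: h', _ => 0 :: place h' t
  | [::], _ => [::]
  end.

Lemma size_place h t : size (place h t) = size h.
Proof. by elim: h t => [|[] h IH] [|x t] //=; rewrite IH. Qed.

Lemma sdot_sgn (c c' : bitseq) : size c = size c' ->
  sdot (sgn c) (sgn c') = (size c)%:Z - 2 * (wt (xorw c c'))%:Z.
Proof.
rewrite /wt; elim: c c' => [|x s IH] [|y t] // [/IH{}IH]; rewrite xorw_cons /= IH.
by case: x y => [] []; lia.
Qed.

Lemma sdot_place_sgn (h c : bitseq) (t : seq int) :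
  size h = size c -> size t = wt h ->
  sdot (place h t) (sgn c) = sdot t (sgn (mask h c)).
Proof.
rewrite /wt; elim: h c t => [|b h IH] [|x c] t //=; first by case: t.
move=> [szc]; case: b => /=; last by rewrite add0n mul0r add0r; apply: IH.
by case: t => [|y t] //=; rewrite add1n => -[szt]; rewrite IH.
Qed.

Lemma sdot_place (h : bitseq) (t u : seq int) :
  size t = wt h -> size u = wt h -> sdot (place h t) (place h u) = sdot t u.
Proof.
rewrite /wt; elim: h t u => [|b h IH] t u /=; first by case: t; case: u.
case: b => /=; last by rewrite !add0n mul0r add0r; apply: IH.
by case: t u => [|x t] [|y u] //=; rewrite !add1n => -[/IH{}IH] [/IH ->].
Qed.

(** Here [j] counts the common positions of [h] and [k] at which the signs differ: each common
    position contributes 4 or -4, and all others contribute 0. *)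
Lemma sdot_place_pm2 (h k : bitseq) (t u : seq int) :
  size h = size k -> size t = wt h -> size u = wt k ->
  all (mem [:: 2; -2]) t -> all (mem [:: 2; -2]) u ->
  exists2 j : nat, (j <= wt (andw h k))%N
  & sdot (place h t) (place k u) = 4 * (wt (andw h k))%:Z - 8 * j%:Z.
Proof.
rewrite /wt; elim: h k t u => [|b h IH] [|c k] t u //; first by exists 0%N.
case=> /IH{}IH; case: b c => [] []; rewrite andw_cons /= ?add1n ?add0n.
- case: t u => [|x t] [|y u] //= [szt] [szu] /andP[xE tE] /andP[yE uE].
  have [j jle ->] := IH t u szt szu tE uE.
  move: xE yE; rewrite !inE => /orP[] /eqP -> /orP[] /eqP ->.
  + by exists j; lia.
  + by exists j.+1; lia.
  + by exists j.+1; lia.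
  + by exists j; lia.
- case: t => [|x t] //= [szt] szu /andP[xE tE] uE.
  have [j jle ->] := IH t u szt szu tE uE.
  by exists j; rewrite ?mulr0 ?add0r.
- case: u => [|x u] //= szt [szu] tE /andP[xE uE].
  have [j jle ->] := IH t u szt szu tE uE.
  by exists j; rewrite ?mul0r ?add0r.
- move=> szt szu tE uE.
  have [j jle ->] := IH t u szt szu tE uE.
  by exists j; rewrite ?mulr0 ?add0r.
Qed.

Lemma sdot_single (i k : nat) (x : int) (s : seq int) :
  sdot (nseq i 0 ++ x :: nseq k 0) s = x * nth 0 s i.
Proof.
have sdot0 n (t : seq int) : sdot (nseq n 0) t = 0.
  by elim: n t => [|n IH] [|y t] //=; rewrite IH mul0r.
elim: i s => [|i IH] [|y s] //=; rewrite ?mulr0 //.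
  by rewrite sdot0 addr0.
by rewrite IH mul0r add0r.
Qed.

(** * Sign patterns on six positions *)

Fixpoint words (n : nat) : seq bitseq :=
  if n is n'.+1 then
    [seq false :: u | u <- words n'] ++ [seq true :: u | u <- words n']
  else [:: [::]].

Lemma mem_words (u : bitseq) : u \in words (size u).
Proof.
elim: u => [|b u IH] //=; rewrite mem_cat.
by case: b; rewrite mem_map ?IH ?orbT // => x y [].
Qed.

(* One representative of each pair {t, -t} of vectors of {2, -2}^6 with an odd
   number of negative entries: the one whose first entry is positive. *)
Definition halves : seq (seq int) :=
  [seq [seq (if b then -2 else 2) | b <- u]
  | u <- words 6 & ~~ head false u && odd (wt u)].

Lemma size_halves : size halves = 16%N.
Proof. by vm_compute. Qed.

Lemma halvesP t : t \in halves ->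
  [/\ size t = 6%N, all (mem [:: 2; -2]) t & sdot t t = 24].
Proof.
have /allP H : all (fun t => [&& size t == 6%N, all (mem [:: 2; -2]) t
  & sdot t t == 24]) halves by vm_compute.
by move=> /H /and3P[/eqP ? ? /eqP ?].
Qed.

(** Two distinct patterns with oddly many minus signs and the same first sign differ in 2 or 4
    places, so the product 24 - 8k is 8 or -8. *)
Lemma sdot_halves : {in halves &, forall t u, t != u -> admissible (sdot t u)}.
Proof.
have H : pairwise (fun t u => admissible (sdot t u)) halves by vm_compute.
by apply: pairwise_sym_in H => t u; rewrite sdotC.
Qed.

(** An odd and an even sign pattern differ in k = 1, 3 or 5 places, so 12 - 4k is 8, 0 or -8. Later
    [u] is the restriction of a codeword to a hexad. *)
Lemma sdot_halves_sgn t u : t \in halves -> size u = 6%N -> ~~ odd (wt u) ->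
  admissible (sdot t (sgn u)).
Proof.
have /allP H : all (fun t => all (fun u => odd (wt u) || admissible (sdot t (sgn u)))
  (words 6)) halves by vm_compute.
move=> /H /allP{}H szu /negPf wu; move: (mem_words u); rewrite szu.
by move=> /H; rewrite wu.
Qed.

(** * Linear codes and their hexads *)

Fixpoint span (m : nat) (G : seq bitseq) : seq bitseq :=
  if G is g :: G' then span m G' ++ [seq xorw g c | c <- span m G']
  else [:: nseq m false].

Lemma xorwK (m : nat) (h c : bitseq) : size h = m -> size c = m ->
  xorw h (xorw h c) = c.
Proof.
by move=> szh szc; rewrite xorwA xorww szh -szc xorwC xorw0.
Qed.

Lemma xorw_cancel (m : nat) (h c d : bitseq) :
  size h = m -> size c = m -> size d = m ->
  xorw (xorw h c) (xorw h d) = xorw c d.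
Proof.
move=> szh szc szd; rewrite (xorwC h c) -xorwA; congr xorw.
exact: xorwK szh szd.
Qed.

Lemma size_span (m : nat) (G : seq bitseq) :
  all (fun g => size g == m) G -> {in span m G, forall c, size c = m}.
Proof.
elim: G => [_ c|g G IH] /=; first by rewrite inE => /eqP ->; rewrite size_nseq.
move=> /andP[/eqP szg /IH{}IH] c; rewrite mem_cat => /orP[/IH //|].
by move=> /mapP[d /IH szd ->]; rewrite size_xorw ?szd.
Qed.

Lemma xorw_span (m : nat) (G : seq bitseq) : all (fun g => size g == m) G ->
  {in span m G &, forall c d, xorw c d \in span m G}.
Proof.
elim: G => [_ c d|g G IH] /=.
  rewrite !inE => /eqP -> /eqP ->; apply/eqP.
  by rewrite -{2}(size_nseq m false) xorw0.
move=> /andP[/eqP szg szG]; have {}IH := IH szG; have szs := size_span szG.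
move=> c d; rewrite !mem_cat => /orP[cG|/mapP[c1 cG ->]] /orP[dG|/mapP[d1 dG ->]].
- by rewrite IH.
- by rewrite xorwA (xorwC c g) -xorwA map_f ?orbT // IH.
- by rewrite -xorwA map_f ?orbT // IH.
- by rewrite (xorw_cancel szg (szs _ cG) (szs _ dG)) IH.
Qed.

Definition hexads (h0 : bitseq) (D : seq bitseq) : seq bitseq :=
  [seq h <- [seq xorw h0 c | c <- D] | wt h == 6].

Record golay_pair (m : nat) (D : seq bitseq) (h0 : bitseq) : Prop := GolayPair {
  golay_uniq : uniq D;
  golay_size : {in D, forall c, size c = m};
  golay_size_rep : size h0 = m;
  golay_xorw : {in D &, forall c d, xorw c d \in D};
  golay_wt : {in D, forall c, wt c \in [:: 0; 8; 12; 16]%N};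
  golay_wt_coset : {in D, forall c, wt (xorw h0 c) %% 4 = 2}%N
}.

(** Closure under sums holds for every span, which leaves checks linear in the number of words,
    apart from [uniq]; the latter expresses linear independence of the generators. *)
Lemma golay_pair_span (m : nat) (G : seq bitseq) (h0 : bitseq) :
  [&& all (fun g => size g == m) G, size h0 == m, uniq (span m G),
      all (fun c => wt c \in [:: 0; 8; 12; 16]%N) (span m G)
    & all (fun c => wt (xorw h0 c) %% 4 == 2)%N (span m G)] ->
  golay_pair m (span m G) h0.
Proof.
move=> /and5P[szG /eqP szh uG /allP wG /allP wC].
split=> //; [exact: size_span|exact: xorw_span|by move=> c /wC /eqP].
Qed.

Definition hexad_vectors (h0 : bitseq) (D : seq bitseq) : seq (seq int) :=
  [seq place h t | h <- hexads h0 D, t <- halves].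

Section GolayPair.

Variables (m : nat) (D : seq bitseq) (h0 : bitseq).
Hypothesis gp : golay_pair m D h0.

Lemma hexadsP (h : bitseq) : h \in hexads h0 D ->
  [/\ wt h = 6%N, size h = m & exists2 c, c \in D & h = xorw h0 c].
Proof.
rewrite mem_filter => /andP[/eqP wh /mapP[c cD hE]]; split=> //; last by exists c.
by rewrite hE size_xorw ?(golay_size_rep gp) // (golay_size gp).
Qed.

Lemma uniq_hexads : uniq (hexads h0 D).
Proof.
apply/filter_uniq; rewrite map_inj_in_uniq ?(golay_uniq gp) // => c d cD dD cd.
by rewrite -(xorwK (golay_size_rep gp) (golay_size gp cD)) cd
  (xorwK (golay_size_rep gp) (golay_size gp dD)).
Qed.

(** The sum has weight 12 - 2i, where i is the size of the intersection; being nonzero and in [D],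
    it has weight 8 or 12. *)
Lemma hexads_meet (h k : bitseq) : h \in hexads h0 D -> k \in hexads h0 D ->
  h != k -> wt (andw h k) \in [:: 0; 2]%N.
Proof.
move=> /hexadsP[wh szh [c cD hE]] /hexadsP[wk szk [d dD kE]] hk.
have hkD : xorw h k \in D.
  by rewrite hE kE (xorw_cancel (golay_size_rep gp)) ?(golay_size gp) // (golay_xorw gp).
have szhk : size h = size k by rewrite szk.
have := wt_xorw szhk; have := golay_wt gp hkD; rewrite wh wk !inE.
have : wt (xorw h k) != 0%N.
  by apply: contraNneq hk => /(wt_xorw_eq0 szhk) ->.
lia.
Qed.

(** Modulo 4, the sum has weight 2 and [c] has weight 0, so 6 + wt c - 2i = 2 forces the size i of
    the intersection to be even. *)
Lemma hexads_code_meet (h c : bitseq) : h \in hexads h0 D -> c \in D ->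
  ~~ odd (wt (andw h c)).
Proof.
move=> /hexadsP[wh szh [d dD hE]] cD.
have szhc : size h = size c by rewrite szh (golay_size gp cD).
have := wt_xorw szhc; have := golay_wt gp cD.
have := golay_wt_coset gp (golay_xorw gp dD cD); rewrite xorwA -hE wh !inE.
lia.
Qed.

Lemma hexad_vectors_norm : {in hexad_vectors h0 D, forall v,
  [/\ size v = m, all (mem [:: 0; 2; -2]) v & sdot v v = 24]}.
Proof.
move=> v /allpairsP[[h t] /= [/hexadsP[wh szh _] /halvesP[szt tE tt] ->]].
split; [by rewrite size_place| |by rewrite sdot_place ?szt].
elim: h t {wh szh szt tt} tE => [|[] h IH] [|x t] //=.
- by rewrite IH.
- by move=> /andP[xE /IH ->]; rewrite inE xE orbT.
- by rewrite IH.
- by move=> tE; rewrite IH.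
Qed.

Lemma hexad_vectors_pairwise :
  pairwise (fun v w => admissible (sdot v w)) (hexad_vectors h0 D).
Proof.
(* Working with the index pairs makes distinctness immediate, without injectivity of [place]. *)
pose I := [seq (h, t) | h <- hexads h0 D, t <- halves].
have -> : hexad_vectors h0 D = [seq place p.1 p.2 | p <- I].
  by rewrite map_allpairs.
have uI : uniq I.
  by apply: allpairs_uniq => [||[? ?] [? ?] //]; [exact: uniq_hexads|vm_compute].
rewrite pairwise_map; rewrite uniq_pairwise in uI.
apply: (@sub_in_pairwise _ (mem I)) uI; last exact/allP.
move=> _ _ /allpairsP[[h t] /= [hH tT ->]] /allpairsP[[k u] /= [kH uT ->]] htku.
have [wh szh _] := hexadsP hH; have [wk szk _] := hexadsP kH.
have [szt tE _] := halvesP tT; have [szu uE _] := halvesP uT.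
case: (eqVneq h k) htku => [hk|hk _] /=.
  rewrite -hk => htu; rewrite sdot_place ?szt ?szu ?wh ?wk //.
  apply: sdot_halves => //; by apply: contraNneq htu => ->.
have szhk : size h = size k by rewrite szk.
have [j jle ->] := sdot_place_pm2 szhk (etrans szt (esym wh))
  (etrans szu (esym wk)) tE uE.
(* Disjoint supports give 0; two common positions give 8 - 8j with j at most 2. *)
have := hexads_meet hH kH hk; rewrite /admissible !inE.
lia.
Qed.

Lemma hexad_vectors_code (v : seq int) (c : bitseq) :
  v \in hexad_vectors h0 D -> c \in D -> admissible (sdot v (sgn c)).
Proof.
move=> /allpairsP[[h t] /= [hH tT ->]] cD.
have [wh szh _] := hexadsP hH; have [szt _ _] := halvesP tT.
have szhc : size h = size c by rewrite szh (golay_size gp cD).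
rewrite sdot_place_sgn ?szt //; apply: sdot_halves_sgn => //.
  by rewrite size_mask.
by rewrite wt_mask // hexads_code_meet.
Qed.

Definition code_vectors : seq (seq int) :=
  [seq 1 :: sgn c | c <- D] ++ [seq 0 :: v | v <- hexad_vectors h0 D].

Variable q : nat.
Hypothesis qm : (q + m = 24)%N.

Lemma code_vectors_norm :
  all (fun v => (size v == m.+1) && (wdot q v v == 24)) code_vectors.
Proof.
rewrite all_cat !all_map; apply/andP; split; apply/allP => x xV /=.
  rewrite size_map (golay_size gp) // eqxx sdot_sgn // xorww /wt count_nseq /=.
  by rewrite (golay_size gp) //; lia.
by have [-> _ ->] := hexad_vectors_norm xV; rewrite !mulr0 eqxx.
Qed.

Lemma code_vectors_pairwise :
  pairwise (fun v w => admissible (wdot q v w)) code_vectors.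
Proof.
rewrite pairwise_cat; apply/and3P; split.
- apply/allrelP => _ _ /mapP[c cD ->] /mapP[v vH ->] /=.
  by rewrite !mulr0 add0r sdotC hexad_vectors_code.
- rewrite pairwise_map; have := golay_uniq gp; rewrite uniq_pairwise.
  apply: (@sub_in_pairwise _ (mem D)); last exact/allP.
  move=> c d cD dD /= cd.
  have szcd : size c = size d by rewrite (golay_size gp cD) (golay_size gp dD).
  rewrite sdot_sgn // (golay_size gp cD).
  (* The weights 8, 12 and 16 turn q + m - 2 wt into 8, 0 and -8. *)
  have := golay_wt gp (golay_xorw gp cD dD).
  have : wt (xorw c d) != 0%N by apply: contraNneq cd => /(wt_xorw_eq0 szcd) ->.
  rewrite /admissible !inE; lia.
- rewrite pairwise_map; apply: sub_pairwise hexad_vectors_pairwise => v w /=.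
  by rewrite !mulr0 add0r.
Qed.

Lemma size_hexad_vectors :
  size (hexad_vectors h0 D) = (size (hexads h0 D) * 16)%N.
Proof. by rewrite size_allpairs size_halves. Qed.

Lemma size_code_vectors :
  size code_vectors = (size D + size (hexads h0 D) * 16)%N.
Proof. by rewrite size_cat !size_map size_hexad_vectors. Qed.

End GolayPair.

(** * Axis vectors for m = 22 *)

Definition axis_vectors : seq (seq int) :=
  [seq 2 :: nseq i 0 ++ x :: nseq (21 - i) 0 | i <- iota 0 22, x <- [:: 4; -4]].

Lemma axis_vectors_norm :
  all (fun v => (size v == 23) && (wdot 2 v v == 24)) axis_vectors.
Proof. by vm_compute. Qed.

(** The heads contribute 2 * 2 * 2 = 8; the tails add 0, or -16 for opposite signs at one
    position. *)
Lemma axis_vectors_pairwise :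
  pairwise (fun v w => admissible (wdot 2 v w)) axis_vectors.
Proof. by vm_compute. Qed.

(** Against a sign vector the heads give 2 * 2 * 1 = 4 and the tails 4 or -4. Against a hexad vector
    only the tails count, giving 4 or -4 times an entry 0, 2 or -2. *)
Lemma axis_code_vectors (D : seq bitseq) (h0 : bitseq) :
  golay_pair 22 D h0 ->
  allrel (fun v w => admissible (wdot 2 v w)) axis_vectors (code_vectors D h0).
Proof.
move=> gp; apply/allrelP => _ w /allpairsPdep[i [x [+ xE ->]]].
rewrite mem_iota add0n => /andP[_ ilt].
rewrite mem_cat => /orP[] /mapP[] => [c cD|v /(hexad_vectors_norm gp)[szv vE _]] ->;
  rewrite [wdot _ _ _]/= sdot_single.
  rewrite (nth_map false) ?(golay_size gp) //.
  by move: xE; rewrite !inE => /orP[] /eqP ->; case: (nth _ _ _).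
have : nth 0 v i \in v by rewrite mem_nth // szv.
move=> /(allP vE); rewrite !inE.
by move: xE; rewrite !inE => /orP[] /eqP -> /or3P[] /eqP ->.
Qed.

(** * The concrete codes from PG(2,4) *)

Definition word (m : nat) (a : pred nat) : bitseq := mkseq a m.

(* {3, 6, 7, 12, 14} is a perfect difference set modulo 21: its translates are
   the lines of PG(2,4).  The sums of two lines span the Golay code shortened at
   three points.  The multiples of 3 form a Baer subplane, and [hyperoval] lies in
   the one of the three classes of hyperovals that fits this choice. *)
Definition even_line_code_gens : seq bitseq :=
  let l := word 21 [pred i | i \in [:: 3; 6; 7; 12; 14]%N] in
  [seq rotr i (xorw l (rotr 1 l)) | i <- iota 0 9].

Definition hyperoval : bitseq := word 21 [pred i | i \in [:: 0; 1; 2; 3; 5; 14]%N].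

Definition baer : bitseq := word 21 (dvdn 3).

Definition D21 : seq bitseq := span 21 even_line_code_gens.

(** Restoring one deleted point, as the new first coordinate, adds one dimension: with it the seven
    points of the Baer subplane form a word of weight 8. *)
Definition D22 : seq bitseq :=
  span 22 ((true :: baer) :: [seq false :: g | g <- even_line_code_gens]).

Lemma golay_pair21 : golay_pair 21 D21 hyperoval.
Proof. by apply: golay_pair_span; vm_compute. Qed.

Lemma golay_pair22 : golay_pair 22 D22 (false :: hyperoval).
Proof. by apply: golay_pair_span; vm_compute. Qed.

Lemma size_D21 : size D21 = 512%N /\ size (hexads hyperoval D21) = 56%N.
Proof. by vm_compute. Qed.

(** The 77 hexads are the 56 hyperovals of the chosen class and the 21 lines, each enlarged by the
    restored point. *)
Lemma size_D22 :
  size D22 = 1024%N /\ size (hexads (false :: hyperoval) D22) = 77%N.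
Proof. by vm_compute. Qed.

Theorem theorem2p15 (R : realType) (d n : nat)
    (hdn : (d, n) \in [:: (21, 896); (22, 1408); (23, 2300)]%N) :
  exists X : {fset 'rV[R]_d},
    [/\ unit_vectors X,
        #|` X| = n,
        biangular_lines X
      & inner_products X `<=` [fset 0; 1 / 3; - (1 / 3)] ].
Proof.
move: hdn; rewrite !inE => /or3P[] /eqP[-> ->].
- move: golay_pair21 size_D21; move: D21 hyperoval => D h0 gp [_ szH].
  have <- : size (hexad_vectors h0 D) = 896%N by rewrite size_hexad_vectors szH.
  (* For q = 1 the head is an ordinary coordinate, so the hexad vectors stay in dimension 21. *)
  have wdot1 v w : size v = 21%N -> wdot 1 v w = sdot v w.
    by case: v w => [|a s] [|b t] //= _; rewrite mul1r.
  apply: (@biangular_of_seqs R 21 1).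
    apply/allP => v vV; have [szv _ vv] := hexad_vectors_norm gp vV.
    by rewrite wdot1 // szv vv !eqxx.
  apply: (@sub_in_pairwise _ (mem (hexad_vectors h0 D)))
    (hexad_vectors_pairwise gp); last exact/allP.
  by move=> v w /(hexad_vectors_norm gp)[szv _ _] _; rewrite /= wdot1.
- move: golay_pair21 size_D21; move: D21 hyperoval => D h0 gp [szD szH].
  have <- : size (code_vectors D h0) = 1408%N.
    by rewrite size_code_vectors szD szH.
  apply: (@biangular_of_seqs R 22 3).
    exact: code_vectors_norm gp _ _.
  exact: code_vectors_pairwise gp _ _.
move: golay_pair22 size_D22; move: D22 (false :: hyperoval) => D h0 gp [szD szH].
have <- : size (axis_vectors ++ code_vectors D h0) = 2300%N.
  by rewrite size_cat size_code_vectors szD szH.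
apply: (@biangular_of_seqs R 23 2).
  by rewrite all_cat axis_vectors_norm (code_vectors_norm gp).
rewrite pairwise_cat axis_vectors_pairwise (code_vectors_pairwise gp) //.
by rewrite (axis_code_vectors gp).
Qed.
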